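(* Let $n\ge 1$. The diagram of all embeddings obtained by successively applying Segre-type embeddings to adjacent factors of the product $\underbrace{Cap_2\times\cdots\times Cap_2}_{n+1\ \text{times}}$, going from this product to $Cap_{2^{n+1}}$, has the structure of an $n$-cube; that is, its graph of vertices and edges is isomorphic to the $n$-dimensional hypercube graph (the graph whose vertices are the $n$-tuples $(x_1,\dots,x_n)$ with $x_i\in\{0,1\}$ and whose edges join two tuples that differ in exactly one entry).
   Context: For $N\ge 1$, $Cap_N=Cap(\Omega_N,\mathcal{A}_N)$ denotes the collection of all probability distributions $p=\langle p_1,\dots,p_N\rangle$ ($p_i\ge 0$, $\sum_i p_i=1$) on a discrete measurable space $\Omega_N$ with $N$ outcomes. The Segre-type embedding $Cap_N\times Cap_M\to Cap_{NM}$ sends $(p,q)$ to the tensor product $p\otimes q=\langle p_iq_j\rangle_{i,j}$, with index pairs ordered lexicographically. In homogeneous coordinates it is induced by the real Segre embedding $\mathbb{P}^{N-1}\times\mathbb{P}^{M-1}\hookrightarrow\mathbb{P}^{NM-1}$, $([p_i],[q_j])\mapsto[p_iq_j]$. The diagram of embeddings of $Cap_2^{\,n+1}$ in $Cap_{2^{n+1}}$ is the following. Its vertices are the formal products obtained from $Cap_2\times\cdots\times Cap_2$ ($n+1$ factors, in this order) by grouping together adjacent factors: for each of the $n$ adjacent positions $(i,i+1)$ one specifies whether the two neighbouring factors are paired (merged) or not, and each maximal group of $k$ consecutive merged factors is replaced by $Cap_{2^k}$. Two different groupings are regarded as different vertices even if the resulting products happen to be isomorphic. Two vertices are joined by an edge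 when one is obtained from the other by applying one Segre-type embedding to a single pair of adjacent factors of the product (identities on the other factors). The initial vertex is $Cap_2^{\,n+1}$ (nothing merged) and the final vertex is $Cap_{2^{n+1}}$ (everything merged). *)

(* Defs.v *)
From mathcomp Require Import all_boot all_order all_algebra.
From mathcomp Require Import reals.
From mathcomp Require Import mxtens.

Set Implicit Arguments.
Unset Strict Implicit.
Unset Printing Implicit Defensive.

Import Order.TTheory GRing.Theory Num.Theory.

Local Open Scope ring_scope.

(** * Probability distributions and Segre-type embeddings *)

Definition is_distr (R : realType) (N : nat) (p : 'rV[R]_N) : bool :=
  [forall i, 0 <= p 0 i] && (\sum_i p 0 i == 1).

Definition cap (R : realType) (N : nat) : Type := {p : 'rV[R]_N | is_distr p}.

(** [mxtens_unindex k = (k %/ M, k %% M)], so the pairs [(i, j)] indexing the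
    entries [p_i q_j] are enumerated lexicographically. *)
Definition tensor (R : realType) (N M : nat) (p : 'rV[R]_N) (q : 'rV[R]_M) :
    'rV[R]_(N * M) :=
  \row_k (p 0 (mxtens_unindex k).1 * q 0 (mxtens_unindex k).2).

Lemma tensor_distr (R : realType) (N M : nat) (p : cap R N) (q : cap R M) :
  is_distr (tensor (val p) (val q)).
Proof.
case: p q => [p /andP[/forallP p0 /eqP p1]] [q /andP[/forallP q0 /eqP q1]] /=.
apply/andP; split.
  by apply/forallP => k; rewrite mxE mulr_ge0.
under eq_bigr => k _ do rewrite mxE.
by rewrite -(mulr_sum (fun i => p 0 i) (fun j => q 0 j)) p1 q1 mulr1.
Qed.

Definition segre (R : realType) (N M : nat) (p : cap R N) (q : cap R M) :
    cap R (N * M) :=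
  exist _ (tensor (val p) (val q)) (tensor_distr p q).

(** The product [Cap_N1 * (... * (Cap_Nr * unit))] for [s = [:: N1; ...; Nr]]. *)
Fixpoint cap_prod (R : realType) (s : seq nat) : Type :=
  if s is N :: s' then (cap R N * cap_prod R s')%type else unit.

(** [segre_step f]: [f] is one Segre-type embedding applied to one pair of
    adjacent factors, and the identity on the other factors. *)
Inductive segre_step (R : realType) :
    forall s t : seq nat, (cap_prod R s -> cap_prod R t) -> Prop :=
| SegreHere (N M : nat) (s : seq nat) :
    @segre_step R [:: N, M & s] ((N * M)%N :: s)
      (fun x => (segre x.1 x.2.1, x.2.2))
| SegreThere (N : nat) (s t : seq nat) (f : cap_prod R s -> cap_prod R t) :
    segre_step f ->
    @segre_step R (N :: s) (N :: t) (fun x => (x.1, f x.2)).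

(** * The diagram *)

(** Sizes of the maximal groups of merged factors, when [m] lists for each
    adjacent position whether the two neighbouring factors are merged; [k] is
    the size reached so far by the group being read. *)
Fixpoint group_sizes (k : nat) (m : seq bool) : seq nat :=
  match m with
  | [::] => [:: k]
  | true :: m' => group_sizes k.+1 m'
  | false :: m' => k :: group_sizes 1 m'
  end.

Definition formal_product (n : nat) (m : n.-tuple bool) : seq nat :=
  [seq (2 ^ k)%N | k <- group_sizes 1 m].

(** A vertex is a formal product arising from a grouping, represented by the
    ordered list of the indices [2 ^ k] of its factors [Cap_(2^k)]. This list
    determines the grouping; e.g. [:: 2; 4] and [:: 4; 2] are distinct. *)
Definition vertex (n : nat) : Type :=
  {s : seq nat | [exists m : n.-tuple bool, s == formal_product m]}.

Definition diagram_edge (R : realType) (n : nat) (v w : vertex n) : Prop :=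
  (exists f : cap_prod R (val v) -> cap_prod R (val w), segre_step f) \/
  (exists f : cap_prod R (val w) -> cap_prod R (val v), segre_step f).

(** * The hypercube graph and graph isomorphisms *)

Definition cube_edge (n : nat) (x y : n.-tuple bool) : Prop :=
  #|[set i | tnth x i != tnth y i]| = 1%N.

Definition graph_isomorphic (V W : Type)
    (eV : V -> V -> Prop) (eW : W -> W -> Prop) : Prop :=
  exists phi : V -> W,
    bijective phi /\ forall v w : V, eV v w <-> eW (phi v) (phi w).

(* Main.v *)
Require Import Defs.
From mathcomp Require Import all_boot all_order all_algebra.
From mathcomp Require Import reals.

(** A vertex of the diagram is determined by the word of [n] bits that says
    which adjacent positions are merged. The word can be read back from the
    list of sizes, from left to right: a group that has collected [k] factors
    [Cap_2] is closed exactly when the size to be read is [2 ^ k], and goes on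
    when that size is larger ([sizes_from_inj]). This gives the bijection with
    the vertices of the cube.

    Under it, one Segre-type embedding is exactly the change of one bit from
    unmerged to merged. The existence of such an embedding between two products
    depends only on the lists of dimensions: one list must come from the other
    by multiplying two neighbours ([segre_stepP]). Comparing two such lists
    from the left shows that the words of bits are in the covering relation of
    the Boolean lattice ([merge_sizes_from]); the point is that every
    factor is a power of [2] larger than [1], so that a product of two factors
    is never mistaken for one of them. Finally, two words are at Hamming
    distance one exactly when one covers the other ([hamming1_cover]). *)

(** The trace of a Segre-type embedding on dimensions, as a boolean so that
    comparing two explicit lists is a computation. *)
Fixpoint merge_adjacent (s t : seq nat) : bool :=
  match s, t with
  | N :: s', K :: t' =>
      (if s' is M :: s'' then (K == N * M) && (s'' == t') else false)
      || (N == K) && merge_adjacent s' t'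
  | _, _ => false
  end.

(** The covering relation of the Boolean lattice, on words of bits. *)
Fixpoint cover (x y : seq bool) : bool :=
  match x, y with
  | a :: x', b :: y' => if a == b then cover x' y' else ~~ a && (x' == y')
  | _, _ => false
  end.

(** The formal product is the case [k = 1]; the size [k] of the group being read
    is left free because it changes along an induction on [m]. *)
Definition sizes_from (k : nat) (m : seq bool) : seq nat :=
  [seq 2 ^ j | j <- group_sizes k m].

(** The maps themselves carry no information: a Segre-type embedding exists as
    soon as the dimensions allow it. *)
Lemma segre_stepP (R : realType) (s t : seq nat) :
  (exists f : cap_prod R s -> cap_prod R t, segre_step f)
  <-> merge_adjacent s t.
Proof.
split=> [[f]|].
  elim=> [N M u|N u v g _ IH] /=; first by rewrite !eqxx.
  by rewrite eqxx IH orbT.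
elim: s t => [|N s IH] [|K t] //= /orP[|/andP[/eqP <- /IH[f fP]]].
  case: s {IH} => [|M s] // /andP[/eqP -> /eqP <-].
  by eexists; apply: SegreHere.
by eexists; apply: SegreThere fP.
Qed.

(** The open group only affects the first factor, and by a shift of the
    exponent: [c] is the number of leading merges in [m]. *)
Lemma sizes_from_head (m : seq bool) :
  exists c r, forall k, sizes_from k m = 2 ^ (k + c) :: r.
Proof.
elim: m => [|[] m [c [r E]]].
- by exists 0, [::] => k; rewrite /sizes_from /= addn0.
- by exists c.+1, r => k; rewrite addnS -addSn -E.
- by exists 0, (sizes_from 1 m) => k; rewrite /sizes_from /= addn0.
Qed.

Lemma sizes_from_inj (k : nat) : injective (sizes_from k).
Proof.
(* The head distinguishes a merge, which yields an exponent above [k], from a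
   closed group, which yields exactly [k]. *)
have head_neq k' x s : sizes_from k'.+1 x <> 2 ^ k' :: s.
  have [c [r ->]] := sizes_from_head x.
  by case=> /eqP; rewrite eqn_exp2l // addSnnS -[X in _ == X]addn0 eqn_add2l.
have neq_nil k' x : sizes_from k' x <> [::].
  by have [c [r ->]] := sizes_from_head x.
move=> x; elim: x k => [|a x IH] k [|b y] //.
- case: b; first by move/esym/head_neq.
  by case=> /esym/neq_nil.
- case: a; first by move/head_neq.
  by case=> /neq_nil.
- case: a b => [] [].
  + by move/IH => ->.
  + by move/head_neq.
  + by move/esym/head_neq.
  + by case=> /IH ->.
Qed.

(** Merging two neighbouring factors is switching on one bit. Reading from the
    left, the two products share all the groups closed before the first bit
    where the words differ; there the merge must take place, and by injectivity the rest
    of the words agree. *)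
Lemma merge_sizes_from (k : nat) (x y : seq bool) :
  size x = size y ->
  merge_adjacent (sizes_from k x) (sizes_from k y) = cover x y.
Proof.
elim: x k y => [|a x IH] k [|b y] //= => [_|[sz]]; first by rewrite /= andbF.
have [c [r Ex]] := sizes_from_head x.
have [d [q Ey]] := sizes_from_head y.
have close u : sizes_from k (false :: u) = 2 ^ k :: sizes_from 1 u by [].
have open u : sizes_from k (true :: u) = sizes_from k.+1 u by [].
have small e : (2 ^ k == 2 ^ (k.+1 + e)) = false.
  by rewrite eqn_exp2l // addSnnS -[X in X == _]addn0 eqn_add2l.
case: a b => [] [].
- by rewrite !open IH.
- rewrite open close Ex [merge_adjacent _ _]/= [2 ^ (k.+1 + c) == _]eq_sym small.
  rewrite orbF /=.
  (* A product whose first factor has exponent above [k] is not [2 ^ k]. *)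
  case: r {Ex} => [|M r] //; apply/negbTE; rewrite negb_and -implybE.
  apply/implyP=> /eqP E; exfalso.
  have: 2 ^ (k.+1 + c) %| 2 ^ k by rewrite E dvdn_mulr.
  by rewrite dvdn_Pexp2l // addSnnS -[X in _ <= X]addn0 leq_add2l.
- rewrite open close Ex Ey [merge_adjacent _ _]/= small orbF /=.
  rewrite -expnD addnA addn1 eq_sym.
  have -> : (x == y) = (sizes_from k.+1 x == sizes_from k.+1 y).
    by rewrite (inj_eq (@sizes_from_inj _)).
  by rewrite Ex Ey.
- rewrite !close /= eqxx IH // {1}Ex.
  (* The factor after the group just closed is at least [2], so the first two
     factors cannot multiply to [2 ^ k]. *)
  by rewrite -expnD addnA addn1 small.
Qed.

Definition hamming (x y : seq bool) : nat :=
  count (fun p => p.1 != p.2) (zip x y).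

Lemma hamming0 (x y : seq bool) :
  size x = size y -> (hamming x y == 0) = (x == y).
Proof.
rewrite /hamming; elim: x y => [|a x IH] [|b y] //= [/IH E].
by rewrite addn_eq0 E eqseq_cons eqb0 negbK.
Qed.

Lemma hamming1_cover (x y : seq bool) :
  size x = size y -> (hamming x y == 1) = cover x y || cover y x.
Proof.
elim: x y => [|a x IH] [|b y] //= [sz].
have -> : hamming (a :: x) (b :: y) = (a != b) + hamming x y by [].
by case: a b => [] [] /=; rewrite ?IH // add1n eqSS hamming0 ?orbF // eq_sym.
Qed.

Lemma card_diff_hamming (n : nat) (x y : n.-tuple bool) :
  #|[set i | tnth x i != tnth y i]| = hamming x y.
Proof.
rewrite cardsE cardE /enum_mem size_filter /hamming.
rewrite -[X in zip X _]map_tnth_enum -[X in zip _ X]map_tnth_enum zip_map.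
by rewrite enumT !count_map.
Qed.

Lemma formal_product_inj (n : nat) : injective (@formal_product n).
Proof. by move=> x y /sizes_from_inj/val_inj. Qed.

Lemma segre_step_cover (R : realType) (n : nat) (x y : n.-tuple bool) :
  (exists f : cap_prod R (formal_product x) -> cap_prod R (formal_product y),
     segre_step f) <-> cover x y.
Proof. by rewrite segre_stepP merge_sizes_from // !size_tuple. Qed.

Theorem theorem2p1p1 (R : realType) (n : nat) (hn : (1 <= n)%N) :
  graph_isomorphic (@diagram_edge R n) (@cube_edge n).
Proof.
pose word (v : vertex n) : n.-tuple bool := xchoose (existsP (valP v)).
have wordP v : val v = formal_product (word v).
  exact/eqP/(xchooseP (existsP (valP v))).
have is_vertex (x : n.-tuple bool) :
    [exists m : n.-tuple bool, formal_product x == formal_product m].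
  by apply/existsP; exists x.
exists word; split.
  exists (fun x => exist _ (formal_product x) (is_vertex x)).
    by move=> v; apply: val_inj; rewrite /= -wordP.
  by move=> x; apply: formal_product_inj; rewrite -wordP.
move=> v w; rewrite /diagram_edge !wordP !segre_step_cover.
rewrite /cube_edge card_diff_hamming.
apply: (iff_trans (rwP orP)).
rewrite -hamming1_cover ?size_tuple //.
exact: iff_sym (rwP eqP).
Qed.
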